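(* Let $\alpha_L,\alpha_R,\mu_L,\mu_R,\gamma_{RL},\gamma_{LR}>0$ and consider on the simplex $\Sigma=\{(L,R)\in\mathbb{R}^2: L\ge 0,\ R\ge 0,\ L+R\le 1\}$ the system \[ \dot L=\alpha_L L C-\mu_L L+\gamma_{RL} R C,\qquad \dot R=\alpha_R R C-\mu_R R+\gamma_{LR} L C,\qquad C=1-L-R. \] Let \[K=\begin{pmatrix}\alpha_L&\gamma_{RL}\\ \gamma_{LR}&\alpha_R\end{pmatrix},\qquad M=\begin{pmatrix}\mu_L&0\\0&\mu_R\end{pmatrix},\] and let $\lambda_{\mathrm{PF}}>0$ be the Perron root (spectral radius) of the positive matrix $M^{-1}K$. Then: (1) If $\lambda_{\mathrm{PF}}\le 1$, the equilibrium $E_0=(0,0)$ is globally asymptotically stable on $\Sigma$. (2) If $\lambda_{\mathrm{PF}}>1$, the system has a unique interior equilibrium $E_1=(L^*,R^* )$ (i.e. an equilibrium with $L^*>0$, $R^*>0$, $L^*+R^*<1$), and $E_1$ is globally asymptotically stable on $\Sigma\setminus\{E_0\}$.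
   Context: Here $L$, $R$, $C$ are the left-radical, right-radical and centrist shares of a normalised electorate; $C=1-L-R$ throughout. *)

(* Defs.v *)
From Stdlib Require Import Reals.
From Coquelicot Require Import Coquelicot.
Open Scope R_scope.

Record mat2 : Type := Mat2 { m11 : R; m12 : R; m21 : R; m22 : R }.

Definition is_eigenvalue (A : mat2) (z : C) : Prop :=
  exists v1 v2 : C, (v1 <> 0%C \/ v2 <> 0%C) /\
    Cplus (Cmult (RtoC (m11 A)) v1) (Cmult (RtoC (m12 A)) v2) = Cmult z v1 /\
    Cplus (Cmult (RtoC (m21 A)) v1) (Cmult (RtoC (m22 A)) v2) = Cmult z v2.

Definition is_spectral_radius (A : mat2) (r : R) : Prop :=
  (exists z, is_eigenvalue A z /\ Cmod z = r) /\
  (forall z, is_eigenvalue A z -> Cmod z <= r).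

Record params : Type := Params
  { aL : R; aR : R; muL : R; muR : R; gRL : R; gLR : R }.

Definition params_pos (p : params) : Prop :=
  0 < aL p /\ 0 < aR p /\ 0 < muL p /\ 0 < muR p /\ 0 < gRL p /\ 0 < gLR p.

Definition fL (p : params) (L Rr : R) : R :=
  let Cc := 1 - L - Rr in aL p * L * Cc - muL p * L + gRL p * Rr * Cc.
Definition fR (p : params) (L Rr : R) : R :=
  let Cc := 1 - L - Rr in aR p * Rr * Cc - muR p * Rr + gLR p * L * Cc.

(* M^{-1} K with K = [[aL, gRL],[gLR, aR]] and M = diag(muL, muR). *)
Definition NGM (p : params) : mat2 :=
  Mat2 (aL p / muL p) (gRL p / muL p) (gLR p / muR p) (aR p / muR p).

Definition in_Sigma (L Rr : R) : Prop := 0 <= L /\ 0 <= Rr /\ L + Rr <= 1.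

Definition is_equilibrium (p : params) (L Rr : R) : Prop :=
  fL p L Rr = 0 /\ fR p L Rr = 0.

Definition is_interior_equilibrium (p : params) (L Rr : R) : Prop :=
  is_equilibrium p L Rr /\ 0 < L /\ 0 < Rr /\ L + Rr < 1.

(* A forward solution: a pair of functions satisfying the ODE for all t >= 0
   (every forward solution on [0,oo) extends a little to the left since the
   vector field is polynomial, so requiring a two-sided derivative at t = 0
   loses nothing). *)
Definition is_solution (p : params) (x y : R -> R) : Prop :=
  forall t, 0 <= t ->
    is_derive x t (fL p (x t) (y t)) /\ is_derive y t (fR p (x t) (y t)).

Definition dist2 (a b c d : R) : R := sqrt ((a - c) ^ 2 + (b - d) ^ 2).

Definition GAS_on (p : params) (D : R -> R -> Prop) (eL eR : R) : Prop :=
  (forall eps, 0 < eps -> exists delta, 0 < delta /\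
     forall x y, is_solution p x y -> D (x 0) (y 0) ->
       dist2 (x 0) (y 0) eL eR < delta ->
       forall t, 0 <= t -> dist2 (x t) (y t) eL eR < eps) /\
  (forall x y, is_solution p x y -> D (x 0) (y 0) ->
     is_lim x p_infty eL /\ is_lim y p_infty eR).

(* Main.v *)
(* A positive vector (w, 1 - w) with K (w, 1 - w) = M (w, 1 - w) / c identifies the spectral radius as 1 / c.
   If c >= 1, the linear function given by a left Perron vector decreases along solutions, at least quadratically in the distance to the origin.
   If c < 1, put N = L + R, z = L / N, n = 1 - c, u = z - w and v = N - n. Then
     z' = - restore * u - turn * v,   N' / N = slope * u - grow * v,
   where restore and grow are positive functions of z and slope is constant. For
     V = Phi(z) + N - n - n ln (N / n),   Phi'(z) = phi(z) (z - w),
   one gets V' = - phi * restore * u^2 + (slope - turn * phi) u v - grow * v^2. This form is negative definite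
   uniformly in z when phi = (slope^2 + eps) / (turn * slope + 2 * grow * restore) with eps > 0 small; here
   turn * slope + grow * restore is a linear function of z, positive on [0, 1].
   Decay of V replaces Poincare-Bendixson. *)
Require Import Defs.
From Stdlib Require Import Reals Lra.
From Coquelicot Require Import Coquelicot.
Open Scope R_scope.

(** * Mean value estimates and differential inequalities *)

Lemma MVT_Derive (f : R -> R) (a b : R) :
  a <= b ->
  (forall t, a <= t <= b -> ex_derive f t) ->
  exists s, a <= s <= b /\ f b - f a = Derive f s * (b - a).
Proof.
intros Hab Hf.
destruct (MVT_gen f a b (Derive f)) as [s [Hs E]].
- rewrite Rmin_left, Rmax_right by lra.
  intros t Ht; apply Derive_correct, Hf; lra.
- rewrite Rmin_left, Rmax_right by lra.
  intros t Ht; apply continuity_pt_filterlim.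
  apply (ex_derive_continuous f t), Hf; lra.
- rewrite Rmin_left, Rmax_right in Hs by lra; eauto.
Qed.

Lemma derive_le_bound (f : R -> R) (a b k : R) :
  a <= b ->
  (forall t, a <= t <= b -> exists v, is_derive f t v /\ v <= k) ->
  f b - f a <= k * (b - a).
Proof.
intros Hab Hf.
destruct (MVT_Derive f a b Hab) as [s [Hs E]].
{ intros t Ht; destruct (Hf t Ht) as [v [Hv _]]; now exists v. }
destruct (Hf s Hs) as [v [Hv Hk]].
rewrite E, (is_derive_unique _ _ _ Hv); nra.
Qed.

(** The integrating factor [exp (- K * t)] reduces the claim to monotonicity, whatever the sign of
    [K]. *)
Lemma gronwall_nonpos (f : R -> R) (K T : R) :
  0 <= T -> f 0 <= 0 ->
  (forall t, 0 <= t <= T -> exists v, is_derive f t v /\ v <= K * f t) ->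
  f T <= 0.
Proof.
intros HT H0 Hf.
assert (H : f T * exp (- K * T) - f 0 * exp (- K * 0) <= 0 * (T - 0)).
{ apply (derive_le_bound (fun t => f t * exp (- K * t)) 0 T 0 HT).
  intros t Ht; destruct (Hf t Ht) as [v [Hv Hk]].
  exists (v * exp (- K * t) + f t * (- K * exp (- K * t))); split.
  - auto_derive; [now exists v | replace (Derive (fun u => f u) t) with v by (symmetry; exact (is_derive_unique _ _ _ Hv)); ring].
  - pose proof (exp_pos (- K * t)); nra. }
rewrite Rmult_0_r, exp_0 in H.
pose proof (exp_pos (- K * T)); nra.
Qed.

(** * Forward invariance of the simplex *)

(** Squaring removes the kink of the negative part at 0, so its growth along a solution can be
    differentiated. *)
Lemma is_derive_sq_neg_part (x : R) :
  is_derive (fun u => Rmin u 0 ^ 2) x (2 * Rmin x 0).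
Proof.
apply is_derive_Reals; intros eps Heps.
exists (mkposreal eps Heps); intros h Hh Hd; simpl in Hd.
(* The first-order remainder is at most [h ^ 2], so [eps] itself serves as the radius. *)
assert (B : Rabs (Rmin (x + h) 0 ^ 2 - Rmin x 0 ^ 2 - 2 * Rmin x 0 * h) <= h ^ 2).
{ apply Rabs_le; unfold Rmin.
  destruct (Rle_dec (x + h) 0), (Rle_dec x 0); split; nra. }
replace ((Rmin (x + h) 0 ^ 2 - Rmin x 0 ^ 2) / h - 2 * Rmin x 0)
  with ((Rmin (x + h) 0 ^ 2 - Rmin x 0 ^ 2 - 2 * Rmin x 0 * h) / h) by (field; auto).
unfold Rdiv; rewrite Rabs_mult, Rabs_inv.
apply Rle_lt_trans with (2 := Hd).
assert (Hp : 0 < Rabs h) by now apply Rabs_pos_lt.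
apply Rmult_le_reg_r with (1 := Hp).
rewrite Rmult_assoc, Rinv_l, Rmult_1_r by lra.
rewrite <- Rabs_mult, (Rabs_pos_eq (h * h)) by nra; lra.
Qed.

Lemma continuous_bounded (f : R -> R) (T : R) :
  0 <= T -> (forall t, 0 <= t <= T -> ex_derive f t) ->
  exists B, forall t, 0 <= t <= T -> Rabs (f t) <= B.
Proof.
intros HT Hf.
destruct (continuity_ab_maj (fun t => Rabs (f t)) 0 T HT) as [s [Hs _]].
- intros t Ht; apply continuity_pt_filterlim.
  apply (continuous_comp f Rabs); [|apply continuous_Rabs].
  apply (ex_derive_continuous f t), Hf; lra.
- now exists (Rabs (f s)).
Qed.

(** Controls recruitment terms such as [gRL p * R * C]. The left side is positive only if [u] and
    exactly one of [v], [w] are negative; it is then a product of two negative parts and a factor of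
    size at most [B]. *)
Lemma neg_part_triple_le (B u v w : R) :
  Rabs u <= B -> Rabs v <= B -> Rabs w <= B ->
  Rmin u 0 * (v * w) <= B * (Rmin u 0 ^ 2 + Rmin v 0 ^ 2 + Rmin w 0 ^ 2).
Proof.
intros Hu Hv Hw.
apply Rabs_le_between in Hu; apply Rabs_le_between in Hv; apply Rabs_le_between in Hw.
assert (HB : 0 <= B) by lra.
assert (M : forall a b k, 0 <= k <= B -> k * (a * b) <= B * ((a ^ 2 + b ^ 2) / 2)).
{ intros a b k Hk.
  assert (a * b <= (a ^ 2 + b ^ 2) / 2) by (pose proof (pow2_ge_0 (a - b)); nra).
  assert (0 <= (a ^ 2 + b ^ 2) / 2) by nra.
  nra. }
assert (S : forall a b c, 0 <= B * (a ^ 2 + b ^ 2 + c ^ 2)).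
{ intros; apply Rmult_le_pos; nra. }
unfold Rmin; destruct (Rle_dec u 0), (Rle_dec v 0), (Rle_dec w 0).
- pose proof (S u v w); assert (0 <= v * w) by nra; nra.
- pose proof (M u v w); pose proof (S u v 0); nra.
- pose proof (M u w v); pose proof (S u w 0); nra.
- pose proof (S u 0 0); assert (0 <= v * w) by nra; nra.
- pose proof (S 0 v w); nra.
- pose proof (S 0 v 0); nra.
- pose proof (S 0 0 w); nra.
- lra.
Qed.

Lemma neg_part_mul_self (u : R) : Rmin u 0 * u = Rmin u 0 ^ 2.
Proof. unfold Rmin; destruct (Rle_dec u 0); ring. Qed.

(* The squared distance to the positive octant in the coordinates (L, R, C) satisfies a linear differential inequality. *)
Lemma Sigma_invariant (p : params) (x y : R -> R) :
  params_pos p -> is_solution p x y -> in_Sigma (x 0) (y 0) ->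
  forall t, 0 <= t -> in_Sigma (x t) (y t).
Proof.
intros [h1 [h2 [h3 [h4 [h5 h6]]]]] Hsol [H1 [H2 H3]] T HT.
destruct (continuous_bounded x T HT) as [B1 HB1].
{ intros t Ht; destruct (Hsol t) as [Hx _]; [lra | eexists; exact Hx]. }
destruct (continuous_bounded y T HT) as [B2 HB2].
{ intros t Ht; destruct (Hsol t) as [_ Hy]; [lra | eexists; exact Hy]. }
(* Boundedness cannot come from invariance here; compactness of [[0, T]] bounds all three
   coordinates. *)
set (B := 1 + B1 + B2).
set (n := fun t => Rmin (x t) 0 ^ 2 + Rmin (y t) 0 ^ 2 + Rmin (1 - x t - y t) 0 ^ 2).
set (S := aL p + aR p + gRL p + gLR p).
(* The coefficients of the cubic terms add up to [2 * S], doubled by differentiating squares; the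
   removal terms feeding [C] give the rest. *)
set (K := 4 * S * B + 2 * (muL p + muR p)).
assert (Hn : n T <= 0).
{ apply gronwall_nonpos with K; [exact HT | |].
  - unfold n; rewrite !Rmin_right by lra; lra.
  - intros t Ht; destruct (Hsol t) as [Hx Hy]; [lra|].
    specialize (HB1 t Ht); specialize (HB2 t Ht).
    assert (D : forall g v, is_derive g t v ->
      is_derive (fun s => Rmin (g s) 0 ^ 2) t (2 * Rmin (g t) 0 * v)).
    { intros g v Hg; rewrite Rmult_comm.
      exact (is_derive_comp (fun u => Rmin u 0 ^ 2) g t _ _ (is_derive_sq_neg_part (g t)) Hg). }
    assert (Hc : is_derive (fun s => 1 - x s - y s) t (- (fL p (x t) (y t) + fR p (x t) (y t)))).
    { auto_derive; [split; [eexists; exact Hx | split; [eexists; exact Hy | exact I]]|].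
      replace (Derive (fun u => x u) t) with (fL p (x t) (y t)) by (symmetry; exact (is_derive_unique _ _ _ Hx)); replace (Derive (fun u => y u) t) with (fR p (x t) (y t)) by (symmetry; exact (is_derive_unique _ _ _ Hy)); ring. }
    eexists; split.
    + unfold n; apply (is_derive_plus (V := R_NormedModule)).
      * apply (is_derive_plus (V := R_NormedModule)); apply D; eassumption.
      * apply (D (fun s => 1 - x s - y s)); exact Hc.
    + assert (HBx : Rabs (x t) <= B) by (unfold B; pose proof (Rabs_pos (y t)); lra).
      assert (HBy : Rabs (y t) <= B) by (unfold B; pose proof (Rabs_pos (x t)); lra).
      assert (HBc : Rabs (1 - x t - y t) <= B).
      { unfold B; apply Rabs_le.
        apply Rabs_le_between in HB1; apply Rabs_le_between in HB2; lra. }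
      unfold n, plus, fL, fR; simpl.
      set (u := x t) in *; set (v := y t) in *; set (w := 1 - u - v) in *.
      pose proof (neg_part_triple_le B u v w HBx HBy HBc) as T1.
      pose proof (neg_part_triple_le B v u w HBy HBx HBc) as T2.
      pose proof (neg_part_mul_self u) as Su; pose proof (neg_part_mul_self v) as Sv.
      pose proof (neg_part_mul_self w) as Sw.
      pose proof (Rmin_l u 0) as Lu; pose proof (Rmin_l v 0) as Lv.
      pose proof (Rmin_r w 0) as Lw.
      set (a := Rmin u 0) in *; set (b := Rmin v 0) in *; set (c := Rmin w 0) in *.
      apply Rabs_le_between in HBx; apply Rabs_le_between in HBy; apply Rabs_le_between in HBc.
      set (m := a ^ 2 + b ^ 2 + c ^ 2) in *.
      assert (Pa : 0 <= a ^ 2) by apply pow2_ge_0; assert (Pb : 0 <= b ^ 2) by apply pow2_ge_0.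
      assert (Pc : 0 <= c ^ 2) by apply pow2_ge_0.
      assert (HB : 0 <= B) by lra.
      assert (G1 : a ^ 2 * w <= B * m) by (unfold m; nra).
      assert (G2 : b ^ 2 * w <= B * m) by (unfold m; nra).
      assert (G3 : - (c ^ 2 * u) <= B * m) by (unfold m; nra).
      assert (G4 : - (c ^ 2 * v) <= B * m) by (unfold m; nra).
      assert (G5 : c * u <= m) by (unfold m; pose proof (pow2_ge_0 (a - c)); nra).
      assert (G6 : c * v <= m) by (unfold m; pose proof (pow2_ge_0 (b - c)); nra).
      (* After regrouping, each negative part meets its own variable, giving a square, or a product
         bounded by [T1], [T2], [G5] or [G6]. *)
      replace (2 * a * (aL p * u * w - muL p * u + gRL p * v * w) +
        2 * b * (aR p * v * w - muR p * v + gLR p * u * w) +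
        2 * c * - (aL p * u * w - muL p * u + gRL p * v * w +
                   (aR p * v * w - muR p * v + gLR p * u * w)))
      with (2 * (aL p * (a * u * w) - muL p * (a * u) + gRL p * (a * (v * w)) +
                 aR p * (b * v * w) - muR p * (b * v) + gLR p * (b * (u * w)) +
                 (aL p + gLR p) * (- (c * w * u)) + (aR p + gRL p) * (- (c * w * v)) +
                 muL p * (c * u) + muR p * (c * v))) by ring.
      rewrite Su, Sv, Sw.
      assert (Hm : forall k X Y, 0 < k -> X <= Y -> k * X <= k * Y) by (intros; nra).
      pose proof (Hm _ _ _ h1 G1); pose proof (Hm _ _ _ h2 G2).
      pose proof (Hm _ _ _ h5 T1).
      assert (T2' : b * (u * w) <= B * m) by (unfold m; lra).
      pose proof (Hm _ _ _ h6 T2').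
      assert (k1 : 0 < aL p + gLR p) by lra; assert (k2 : 0 < aR p + gRL p) by lra.
      pose proof (Hm _ _ _ k1 G3); pose proof (Hm _ _ _ k2 G4).
      pose proof (Hm _ _ _ h3 G5); pose proof (Hm _ _ _ h4 G6).
      assert (0 <= muL p * a ^ 2) by (apply Rmult_le_pos; lra); assert (0 <= muR p * b ^ 2) by (apply Rmult_le_pos; lra).
      apply Rle_trans with (K * m); [unfold K, S; lra | apply Req_le; unfold m; ring]. }
assert (N : forall u, u < 0 -> 0 < Rmin u 0 ^ 2).
{ intros u Hu; rewrite Rmin_left by lra; nra. }
unfold n in Hn.
pose proof (pow2_ge_0 (Rmin (x T) 0)); pose proof (pow2_ge_0 (Rmin (y T) 0)).
pose proof (pow2_ge_0 (Rmin (1 - x T - y T) 0)).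
split; [|split]; apply Rnot_lt_le; intros Hlt.
- specialize (N _ Hlt); lra.
- specialize (N _ Hlt); lra.
- assert (Hc : 1 - x T - y T < 0) by lra; specialize (N _ Hc); lra.
Qed.

(** * Lyapunov's direct method *)

Lemma dist2_sq (a b c d : R) : dist2 a b c d ^ 2 = (a - c) ^ 2 + (b - d) ^ 2.
Proof. unfold dist2; apply pow2_sqrt, Rplus_le_le_0_compat; apply pow2_ge_0. Qed.

Lemma dist2_ge0 (a b c d : R) : 0 <= dist2 a b c d.
Proof. apply sqrt_pos. Qed.


Lemma GAS_of_lyapunov (p : params) (D : R -> R -> Prop) (eL eR : R)
    (V : R -> R -> R) (c : R) :
  0 < c ->
  (forall x y, is_solution p x y -> D (x 0) (y 0) -> forall t, 0 <= t -> D (x t) (y t)) ->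
  (forall a b, D a b -> c * dist2 a b eL eR ^ 2 <= V a b) ->
  (forall beta, 0 < beta -> exists delta, 0 < delta /\
     forall a b, D a b -> dist2 a b eL eR < delta -> V a b < beta) ->
  (forall x y t, is_solution p x y -> 0 <= t -> D (x t) (y t) ->
     exists v, is_derive (fun s => V (x s) (y s)) t v /\
               v <= - c * dist2 (x t) (y t) eL eR ^ 2) ->
  GAS_on p D eL eR.
Proof.
intros Hc Hinv Hlow Hup Hdec.
(* Stability is stated from an arbitrary time [s], so that attraction can restart it once the
   solution has come close. *)
assert (Hstab : forall eps, 0 < eps -> exists delta, 0 < delta /\
  forall x y, is_solution p x y -> D (x 0) (y 0) -> forall s, 0 <= s ->
    dist2 (x s) (y s) eL eR < delta ->
    forall t, s <= t -> dist2 (x t) (y t) eL eR < eps).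
{ intros eps Heps.
  destruct (Hup (c * eps ^ 2)) as [delta [Hd Hdelta]].
  { apply Rmult_lt_0_compat; [lra | nra]. }
  exists delta; split; [exact Hd|]; intros x y Hsol H0 s Hs Hds t Hst.
  pose proof (Hdelta _ _ (Hinv x y Hsol H0 s Hs) Hds) as HV.
  assert (HVt : V (x t) (y t) - V (x s) (y s) <= 0 * (t - s)).
  { apply (derive_le_bound (fun u => V (x u) (y u))); [exact Hst|].
    intros u Hu; destruct (Hdec x y u Hsol) as [v [Hv Hle]]; [lra | apply Hinv; auto; lra |].
    exists v; split; [exact Hv|].
    pose proof (pow2_ge_0 (dist2 (x u) (y u) eL eR)); nra. }
  assert (Ht : 0 <= t) by lra.
  pose proof (Hlow _ _ (Hinv x y Hsol H0 t Ht)) as Hl.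
  apply Rnot_le_lt; intros Hge.
  assert (eps ^ 2 <= dist2 (x t) (y t) eL eR ^ 2) by (apply pow_incr; lra).
  nra. }
split.
- intros eps Heps; destruct (Hstab eps Heps) as [delta [Hd Hdelta]].
  exists delta; split; [exact Hd|]; intros x y Hsol H0 Hd0 t Ht.
  now apply (Hdelta x y Hsol H0 0 (Rle_refl 0)).
- intros x y Hsol H0.
  assert (Hev : forall eps, 0 < eps ->
    exists s, 0 <= s /\ forall t, s <= t -> dist2 (x t) (y t) eL eR < eps).
  { intros eps Heps; destruct (Hstab eps Heps) as [delta [Hd Hdelta]].
    (* By this time, decay at rate [c * delta ^ 2] would have pushed [V] down to [-1] or below. *)
    set (T := (V (x 0) (y 0) + 1) / (c * delta ^ 2)).
    assert (Hcd : 0 < c * delta ^ 2) by (apply Rmult_lt_0_compat; nra).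
    assert (HV : forall t, 0 <= t -> 0 <= V (x t) (y t)).
    { intros t Ht; pose proof (Hlow _ _ (Hinv x y Hsol H0 t Ht)).
      pose proof (pow2_ge_0 (dist2 (x t) (y t) eL eR)); nra. }
    assert (HT : 0 <= T).
    { apply Rmult_le_pos; [pose proof (HV 0 (Rle_refl 0)); lra|].
      now apply Rlt_le, Rinv_0_lt_compat. }
    (* Either the solution enters the [delta]-ball and stability traps it, or [V] decreases at a
       fixed rate up to [T] and becomes negative. *)
    destruct (Classical_Prop.classic
      (exists s, 0 <= s /\ dist2 (x s) (y s) eL eR < delta)) as [[s [Hs Hds]]|Hno].
    - exists s; split; [exact Hs|]; now apply (Hdelta x y Hsol H0 s Hs).
    - exfalso.
      assert (HVT : V (x T) (y T) - V (x 0) (y 0) <= - (c * delta ^ 2) * (T - 0)).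
      { apply (derive_le_bound (fun u => V (x u) (y u))); [exact HT|].
        intros u Hu; destruct (Hdec x y u Hsol) as [v [Hv Hle]]; [lra | apply Hinv; auto; lra |].
        exists v; split; [exact Hv|].
        assert (delta <= dist2 (x u) (y u) eL eR).
        { apply Rnot_lt_le; intros Hlt; apply Hno; exists u; split; [lra | exact Hlt]. }
        assert (delta ^ 2 <= dist2 (x u) (y u) eL eR ^ 2) by (apply pow_incr; lra).
        nra. }
      assert (E : c * delta ^ 2 * T = V (x 0) (y 0) + 1) by (unfold T; field; split; nra).
      pose proof (HV T HT); nra. }
  assert (Hcoord : forall u v e,
    (forall t, (u t - e) ^ 2 <= dist2 (x t) (y t) eL eR ^ 2) -> v = e -> is_lim u p_infty (Finite v)).
  { intros u v e Hu ->; apply is_lim_spec; intros eps.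
    destruct (Hev eps (cond_pos eps)) as [s [Hs Hlt]].
    exists s; intros t Ht.
    apply Rle_lt_trans with (dist2 (x t) (y t) eL eR); [|apply Hlt; lra].
    rewrite <- (Rabs_pos_eq (dist2 (x t) (y t) eL eR)) by apply dist2_ge0.
    apply Rsqr_le_abs_0; rewrite !Rsqr_pow2; apply Hu. }
  split; eapply Hcoord; try reflexivity; intros t; rewrite dist2_sq; pose proof (pow2_ge_0 (x t - eL)); pose proof (pow2_ge_0 (y t - eR)); lra.
Qed.

(** * Perron vector, interior equilibria and spectral radius *)

(** [growL p z] and [growR p z] are the components of [K (z, 1 - z)]: recruitment per unit of [C]
    and of [L + R] when the left share of the radicals is [z]. *)
Definition growL (p : params) (z : R) : R := aL p * z + gRL p * (1 - z).
Definition growR (p : params) (z : R) : R := gLR p * z + aR p * (1 - z).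

(* [(w, 1 - w)] is the normalised Perron vector of [NGM p] and [/ c] its Perron root. *)
Definition is_perron (p : params) (w c : R) : Prop :=
  0 < w < 1 /\ 0 < c /\
  muL p * w = c * growL p w /\ muR p * (1 - w) = c * growR p w.

Lemma growL_gt0 (p : params) (z : R) : params_pos p -> 0 <= z <= 1 -> 0 < growL p z.
Proof. intros [h1 [h2 [h3 [h4 [h5 h6]]]]] Hz; unfold growL; nra. Qed.

Lemma growR_gt0 (p : params) (z : R) : params_pos p -> 0 <= z <= 1 -> 0 < growR p z.
Proof. intros [h1 [h2 [h3 [h4 [h5 h6]]]]] Hz; unfold growR; nra. Qed.

(** [P] is the cross product of [M (z, 1 - z)] and [K (z, 1 - z)], so its zeros are the parallel
    directions. It equals [- muR p * gRL p] at 0 and [muL p * gLR p] at 1, which forces a zero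
    strictly inside. *)
Lemma perron_exists (p : params) : params_pos p -> exists w c, is_perron p w c.
Proof.
intros Hp; pose proof Hp as [h1 [h2 [h3 [h4 [h5 h6]]]]].
set (P := fun z => muL p * z * growR p z - muR p * (1 - z) * growL p z).
destruct (IVT P 0 1) as [w [Hw HP]].
- intros z; apply continuity_pt_filterlim, (ex_derive_continuous P z).
  unfold P, growL, growR; auto_derive; exact I.
- lra.
- unfold P, growL, growR; nra.
- unfold P, growL, growR; nra.
- assert (Hw' : 0 < w < 1).
  { split; apply Rnot_le_lt; intros Hle; unfold P, growL, growR in HP.
    - replace w with 0 in HP by lra; nra.
    - replace w with 1 in HP by lra; nra. }
  pose proof (growL_gt0 p w Hp Hw) as HL; pose proof (growR_gt0 p w Hp Hw) as HR.
  exists w, (muL p * w / growL p w); split; [exact Hw'|]; split; [|split].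
  + apply Rdiv_lt_0_compat; nra.
  + field; lra.
  + unfold P in HP; apply Rmult_eq_reg_r with (growL p w); [|lra].
    transitivity (muL p * w * growR p w); [lra | field; lra].
Qed.

(** Eliminates the removal rates, so that later identities become rational identities in [w] and
    [c]. *)
Lemma perron_mu (p : params) (w c : R) :
  is_perron p w c ->
  muL p = c * growL p w / w /\ muR p = c * growR p w / (1 - w).
Proof.
intros [Hw [Hc [E1 E2]]]; split.
- rewrite <- E1; field; lra.
- rewrite <- E2; field; lra.
Qed.

(** The quadratic whose zeros are the Perron directions factors as [w' - w] times an affine function
    that is positive on [[0, 1]]. *)
Lemma perron_unique (p : params) (w c w' c' : R) :
  params_pos p -> is_perron p w c -> is_perron p w' c' -> w' = w /\ c' = c.
Proof.
intros Hp H H'; pose proof (perron_mu p w c H) as [M1 M2].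
destruct H as [Hw [Hc [E1 E2]]], H' as [Hw' [Hc' [E1' E2']]].
pose proof Hp as [h1 [h2 [h3 [h4 [h5 h6]]]]].
assert (EP : (w' - w) * (gRL p * muR p / w * (1 - w') + gLR p * muL p / (1 - w) * w') = 0).
{ transitivity (muL p * w' * growR p w' - muR p * (1 - w') * growL p w').
  - rewrite M1, M2; unfold growL, growR; field; lra.
  - rewrite E1', E2'; ring. }
assert (0 < gRL p * muR p / w) by (apply Rdiv_lt_0_compat; nra).
assert (0 < gLR p * muL p / (1 - w)) by (apply Rdiv_lt_0_compat; nra).
assert (Ew : w' = w).
{ apply Rmult_integral in EP; destruct EP as [EP|EP]; [lra | nra]. }
split; [exact Ew|]; subst w'.
assert (Hw1 : 0 <= w <= 1) by lra.
pose proof (growL_gt0 p w Hp Hw1); apply Rmult_eq_reg_r with (growL p w); lra.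
Qed.

(** At an equilibrium [C K (L, R) = M (L, R)]; dividing by [L + R] normalises the vector. Uniqueness
    of equilibria thus reduces to uniqueness of Perron pairs. *)
Lemma interior_equilibrium_perron (p : params) (L R : R) :
  is_interior_equilibrium p L R -> is_perron p (L / (L + R)) (1 - L - R).
Proof.
intros [[E1 E2] [HL [HR HS]]]; unfold fL, fR in E1, E2; unfold is_perron, growL, growR.
repeat split.
- apply Rdiv_lt_0_compat; lra.
- apply Rmult_lt_reg_r with (L + R); [lra|].
  unfold Rdiv; rewrite Rmult_assoc, Rinv_l; lra.
- lra.
- apply Rminus_diag_uniq; replace (_ - _) with
    (- (aL p * L * (1 - L - R) - muL p * L + gRL p * R * (1 - L - R)) / (L + R)) by (field; lra).
  rewrite E1; field; lra.
- apply Rminus_diag_uniq; replace (_ - _) with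
    (- (aR p * R * (1 - L - R) - muR p * R + gLR p * L * (1 - L - R)) / (L + R)) by (field; lra).
  rewrite E2; field; lra.
Qed.

Lemma perron_interior_equilibrium (p : params) (w c : R) :
  is_perron p w c -> c < 1 ->
  is_interior_equilibrium p (w * (1 - c)) ((1 - w) * (1 - c)).
Proof.
intros [Hw [Hc [E1 E2]]] Hc1; unfold growL, growR in E1, E2; unfold is_interior_equilibrium.
repeat split; try nra; unfold fL, fR.
- replace (1 - _ - _) with c by ring.
  replace (muL p * (w * (1 - c))) with (muL p * w * (1 - c)) by ring; rewrite E1; ring.
- replace (1 - _ - _) with c by ring.
  replace (muR p * ((1 - w) * (1 - c))) with (muR p * (1 - w) * (1 - c)) by ring; rewrite E2; ring.
Qed.

(* Comparison in the maximum norm weighted by the positive vector [(w1, w2)]. *)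
Lemma eigenvalue_le_of_positive_vector (A : mat2) (w1 w2 r : R) (z : C) :
  0 <= m11 A -> 0 <= m12 A -> 0 <= m21 A -> 0 <= m22 A -> 0 < w1 -> 0 < w2 ->
  m11 A * w1 + m12 A * w2 = r * w1 -> m21 A * w1 + m22 A * w2 = r * w2 ->
  is_eigenvalue A z -> Cmod z <= r.
Proof.
intros H11 H12 H21 H22 Hw1 Hw2 E1 E2 [v1 [v2 [Hv [F1 F2]]]].
assert (T : forall a b v, 0 <= a -> 0 <= b -> Cplus (Cmult (RtoC a) v1) (Cmult (RtoC b) v2) = Cmult z v ->
  Cmod z * Cmod v <= a * Cmod v1 + b * Cmod v2).
{ intros a b v Ha Hb E; rewrite <- Cmod_mult, <- E.
  eapply Rle_trans; [apply Cmod_triangle|].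
  rewrite !Cmod_mult, !Cmod_R, !Rabs_pos_eq by assumption; lra. }
pose proof (T _ _ _ H11 H12 F1) as T1; pose proof (T _ _ _ H21 H22 F2) as T2.
pose proof (Cmod_ge_0 v1) as G1; pose proof (Cmod_ge_0 v2) as G2.
assert (G : 0 < Cmod v1 \/ 0 < Cmod v2) by (destruct Hv as [Hv|Hv]; [left|right]; now apply Cmod_gt_0).
set (s1 := Cmod v1) in *; set (s2 := Cmod v2) in *; set (m := Cmod z) in *.
(* The row used is the one where the ratio of [Cmod] of the entry to its weight is largest. *)
destruct (Rle_lt_dec (s2 * w1) (s1 * w2)) as [Hle|Hlt].
- assert (Hs : 0 < s1) by (destruct G; nra).
  assert (X : m12 A * (s2 * w1) <= m12 A * (s1 * w2)) by (apply Rmult_le_compat_l; lra).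
  apply Rmult_le_reg_r with (s1 * w1); [nra|]; nra.
- assert (Hs : 0 < s2) by nra.
  assert (X : m21 A * (s1 * w2) <= m21 A * (s2 * w1)) by (apply Rmult_le_compat_l; lra).
  apply Rmult_le_reg_r with (s2 * w2); [nra|]; nra.
Qed.

(** The weighted norm bounds every eigenvalue by [/ c], and [/ c] is itself an eigenvalue with
    eigenvector [(w, 1 - w)]. *)
Lemma spectral_radius_perron (p : params) (lam w c : R) :
  params_pos p -> is_perron p w c -> is_spectral_radius (NGM p) lam -> lam * c = 1.
Proof.
intros Hp [Hw [Hc [E1 E2]]] [[z [Hz Hlam]] Hmax].
destruct Hp as [h1 [h2 [h3 [h4 [h5 h6]]]]].
unfold growL, growR in E1, E2.
assert (I : forall a b, 0 < a -> 0 < b -> 0 <= a / b) by (intros; apply Rlt_le, Rdiv_lt_0_compat; lra).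
assert (F1 : aL p / muL p * w + gRL p / muL p * (1 - w) = / c * w).
{ apply Rmult_eq_reg_r with (muL p * c); [|nra].
  replace (/ c * w * (muL p * c)) with (muL p * w) by (field; lra).
  rewrite E1; field; lra. }
assert (F2 : gLR p / muR p * w + aR p / muR p * (1 - w) = / c * (1 - w)).
{ apply Rmult_eq_reg_r with (muR p * c); [|nra].
  replace (/ c * (1 - w) * (muR p * c)) with (muR p * (1 - w)) by (field; lra).
  rewrite E2; field; lra. }
assert (U : lam <= / c).
{ rewrite <- Hlam; apply (eigenvalue_le_of_positive_vector (NGM p) w (1 - w)); simpl; auto; lra. }
assert (W : / c <= lam).
{ rewrite <- (Rabs_pos_eq (/ c)) by (apply Rlt_le, Rinv_0_lt_compat; lra).
  rewrite <- Cmod_R; apply Hmax.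
  exists (RtoC w), (RtoC (1 - w)); simpl; split; [|split].
  - left; intros E; injection E; lra.
  - rewrite <- !RtoC_mult, <- RtoC_plus; now f_equal.
  - rewrite <- !RtoC_mult, <- RtoC_plus; now f_equal. }
replace lam with (/ c) by lra; field; lra.
Qed.

(** * Global stability of the origin at or below the threshold *)

(** The derivative of the linear function is [(C / c - 1) * W], with [W] the weighted removal. For
    [c >= 1] the factor is at most [- (L + R)], so the critical case [c = 1] needs no separate
    treatment. *)
Lemma GAS_origin (p : params) (w c : R) :
  params_pos p -> is_perron p w c -> 1 <= c -> GAS_on p in_Sigma 0 0.
Proof.
intros Hp HP Hc1; pose proof (perron_mu p w c HP) as [M1 M2].
pose proof Hp as [h1 [h2 [h3 [h4 [h5 h6]]]]].
destruct HP as [Hw [Hc _]].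
(* [(gLR p, pR)] is a left Perron vector of [M^{-1} K], multiplied by [M^{-1}]. *)
set (pR := gRL p * (1 - w) / w).
assert (HpR : 0 < pR) by (apply Rdiv_lt_0_compat; nra).
set (k := Rmin (Rmin (gLR p) pR) (Rmin (gLR p * muL p) (pR * muR p))).
assert (Hk : 0 < k) by (unfold k; repeat apply Rmin_pos; nra).
assert (k1 : k <= gLR p) by (unfold k; eapply Rle_trans; [apply Rmin_l | apply Rmin_l]).
assert (k2 : k <= pR) by (unfold k; eapply Rle_trans; [apply Rmin_l | apply Rmin_r]).
assert (k3 : k <= gLR p * muL p) by (unfold k; eapply Rle_trans; [apply Rmin_r | apply Rmin_l]).
assert (k4 : k <= pR * muR p) by (unfold k; eapply Rle_trans; [apply Rmin_r | apply Rmin_r]).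
apply (GAS_of_lyapunov p in_Sigma 0 0 (fun a b => gLR p * a + pR * b) k Hk).
- intros x y Hsol H0; now apply (Sigma_invariant p).
- intros a b [Ha [Hb Hab]]; rewrite dist2_sq.
  (* Coordinates in the simplex are at most 1, so a linear function dominates the squared
     distance. *)
  assert (a ^ 2 + b ^ 2 <= a + b) by nra; nra.
- intros beta Hbeta; set (s := gLR p + pR + 1).
  exists (beta / s); split; [apply Rdiv_lt_0_compat; unfold s; lra|].
  intros a b [Ha [Hb Hab]] Hd.
  pose proof (dist2_sq a b 0 0) as E; pose proof (dist2_ge0 a b 0 0) as G.
  set (d := dist2 a b 0 0) in *.
  assert (Hds : s * d < beta).
  { apply Rmult_lt_compat_l with (r := s) in Hd; [|unfold s; lra].
    replace (s * (beta / s)) with beta in Hd by (field; unfold s; lra); exact Hd. }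
  assert (a <= d) by nra; assert (b <= d) by nra.
  unfold s in Hds; nra.
- intros x y t Hsol Ht [Ha [Hb Hab]]; destruct (Hsol t Ht) as [Hx Hy].
  exists (gLR p * fL p (x t) (y t) + pR * fR p (x t) (y t)); split.
  + apply (is_derive_plus (V := R_NormedModule)); now apply is_derive_scal.
  + rewrite dist2_sq; set (a := x t) in *; set (b := y t) in *.
    set (W := gLR p * muL p * a + pR * muR p * b).
    replace (gLR p * fL p a b + pR * fR p a b) with (((1 - a - b) / c - 1) * W).
    2:{ unfold W, pR, fL, fR; rewrite M1, M2; unfold growL, growR; field; lra. }
    assert (HW : k * (a + b) <= W) by (unfold W; nra).
    assert (Hq : (1 - a - b) / c <= 1 - a - b).
    { apply Rmult_le_reg_r with c; [lra|].
      replace ((1 - a - b) / c * c) with (1 - a - b) by (field; lra); nra. }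
    assert (HW0 : 0 <= k * (a + b)) by nra.
    apply Rle_trans with (- (a + b) * W); [apply Rmult_le_compat_r; lra|].
    assert ((a + b) * (k * (a + b)) <= (a + b) * W) by (apply Rmult_le_compat_l; lra).
    assert (0 <= k * (a * b)) by (repeat apply Rmult_le_pos; lra).
    lra.
Qed.

(** * Dynamics in share and total, and the weight that makes the form definite *)

Definition grow (p : params) (z : R) : R := growL p z + growR p z.
Definition turn (p : params) (z : R) : R := (1 - z) * growL p z - z * growR p z.
(** At [C = c] the relative growth of [N] is affine in [z] and vanishes at [w]; this is its
    slope. *)
Definition slope (p : params) (c : R) : R :=
  c * (aL p + gLR p - aR p - gRL p) - (muL p - muR p).
(** At [C = c] the velocity of [z] is a quadratic vanishing at [w]; [- restore] is its affine
    cofactor, interpolated from [z = 0] and [z = 1]. *)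
Definition restore (p : params) (w c z : R) : R :=
  c * (gRL p / w) * (1 - z) + c * (gLR p / (1 - w)) * z.
(** The cofactor of [z - w] in [muL p * z * growR p z - muR p * (1 - z) * growL p z]. *)
Definition gap (p : params) (w z : R) : R :=
  gRL p * muR p / w * (1 - z) + gLR p * muL p / (1 - w) * z.

(** With [L = z N] and [R = (1 - z) N], the left sides are [N z'] and [N']; no division by [N] is
    involved. *)
Lemma share_dynamics (p : params) (w c z N : R) :
  is_perron p w c ->
  (1 - z) * fL p (z * N) ((1 - z) * N) - z * fR p (z * N) ((1 - z) * N)
    = N * (- (z - w) * restore p w c z - turn p z * (N - (1 - c))) /\
  fL p (z * N) ((1 - z) * N) + fR p (z * N) ((1 - z) * N)
    = N * (slope p c * (z - w) - grow p z * (N - (1 - c))).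
Proof.
intros H; pose proof (perron_mu p w c H) as [M1 M2]; destruct H as [Hw _].
unfold restore, turn, slope, grow, fL, fR; rewrite M1, M2; unfold growL, growR.
split; field; lra.
Qed.

(* Positivity of [gap] on [0, 1] expresses that the nullclines of [z] and [N] cross only once. *)
Lemma gap_eq (p : params) (w c z : R) :
  is_perron p w c ->
  turn p z * slope p c + grow p z * restore p w c z = gap p w z.
Proof.
intros H; pose proof (perron_mu p w c H) as [M1 M2]; destruct H as [Hw _].
unfold gap, restore, turn, slope, grow; rewrite M1, M2; unfold growL, growR; field; lra.
Qed.

(** The smaller eigenvalue of a positive definite 2 by 2 matrix is at least determinant over trace;
    here the determinant is at least [d / 4] and the trace at most [S]. *)
Lemma definite_form_bound (X Y B S d u v : R) :
  0 <= X -> 0 <= Y -> 0 < S -> X + Y <= S -> 0 < d -> d <= 4 * X * Y - B ^ 2 ->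
  d / (4 * S) * (u ^ 2 + v ^ 2) <= X * u ^ 2 - B * u * v + Y * v ^ 2.
Proof.
intros HX HY HS HXY Hd HD.
set (e := d / (4 * S)).
assert (He : 4 * S * e = d) by (unfold e; field; lra).
assert (He0 : 0 < e) by (apply Rdiv_lt_0_compat; lra).
assert (Hxy : d <= 4 * X * Y) by (pose proof (pow2_ge_0 B); lra).
assert (HeX : 0 < X - e).
{ apply Rnot_le_lt; intros Hle.
  assert (Hsum : (X + Y) * e <= S * e) by (apply Rmult_le_compat_r; lra).
  assert (Hle' : X * Y <= e * Y) by (apply Rmult_le_compat_r; lra).
  assert (Hxe : X * e <= 0) by lra.
  assert (X = 0) by nra.
  subst X; lra. }
assert (HdetE : B ^ 2 <= 4 * (X - e) * (Y - e)) by nra.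
apply Rmult_le_reg_l with (4 * (X - e)); [lra|].
pose proof (pow2_ge_0 (2 * (X - e) * u - B * v)).
pose proof (pow2_ge_0 v).
assert (0 <= (4 * (X - e) * (Y - e) - B ^ 2) * v ^ 2) by (apply Rmult_le_pos; lra).
nra.
Qed.

Lemma segment_bounds (f0 f1 lo hi z : R) :
  0 <= z <= 1 -> lo <= f0 <= hi -> lo <= f1 <= hi ->
  lo <= f0 * (1 - z) + f1 * z <= hi.
Proof. intros; split; nra. Qed.

(** The first three coefficients are affine in [z] with positive values at 0 and 1, and [turn] is
    bounded by [grow] in absolute value. *)
Lemma coefficient_bounds (p : params) (w c : R) :
  params_pos p -> is_perron p w c ->
  exists lo hi, 0 < lo /\ 0 < hi /\ forall z, 0 <= z <= 1 ->
    lo <= grow p z <= hi /\ lo <= restore p w c z <= hi /\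
    lo <= gap p w z <= hi /\ turn p z ^ 2 <= hi ^ 2.
Proof.
intros Hp [Hw [Hc _]]; pose proof Hp as [h1 [h2 [h3 [h4 [h5 h6]]]]].
set (a0 := gRL p + aR p); set (a1 := aL p + gLR p).
set (b0 := c * (gRL p / w)); set (b1 := c * (gLR p / (1 - w))).
set (e0 := gRL p * muR p / w); set (e1 := gLR p * muL p / (1 - w)).
assert (Ha0 : 0 < a0) by (unfold a0; lra); assert (Ha1 : 0 < a1) by (unfold a1; lra).
assert (Hb0 : 0 < b0) by (apply Rmult_lt_0_compat; [lra | apply Rdiv_lt_0_compat; lra]).
assert (Hb1 : 0 < b1) by (apply Rmult_lt_0_compat; [lra | apply Rdiv_lt_0_compat; lra]).
assert (He0 : 0 < e0) by (apply Rdiv_lt_0_compat; nra).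
assert (He1 : 0 < e1) by (apply Rdiv_lt_0_compat; nra).
set (lo := Rmin (Rmin a0 a1) (Rmin (Rmin b0 b1) (Rmin e0 e1))).
exists lo, (a0 + a1 + b0 + b1 + e0 + e1).
assert (Hlo : 0 < lo) by (unfold lo; repeat apply Rmin_pos; assumption).
pose proof (Rmin_l (Rmin a0 a1) (Rmin (Rmin b0 b1) (Rmin e0 e1))).
pose proof (Rmin_r (Rmin a0 a1) (Rmin (Rmin b0 b1) (Rmin e0 e1))).
pose proof (Rmin_l (Rmin b0 b1) (Rmin e0 e1)); pose proof (Rmin_r (Rmin b0 b1) (Rmin e0 e1)).
pose proof (Rmin_l a0 a1); pose proof (Rmin_r a0 a1).
pose proof (Rmin_l b0 b1); pose proof (Rmin_r b0 b1).
pose proof (Rmin_l e0 e1); pose proof (Rmin_r e0 e1).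
fold lo in H, H0.
split; [exact Hlo|]; split; [lra|]; intros z Hz.
assert (HA : lo <= grow p z <= a0 + a1 + b0 + b1 + e0 + e1).
{ replace (grow p z) with (a0 * (1 - z) + a1 * z) by (unfold grow, growL, growR, a0, a1; ring).
  apply segment_bounds; lra. }
split; [exact HA|]; split; [unfold restore; fold b0 b1; apply segment_bounds; lra|].
split; [unfold gap; fold e0 e1; apply segment_bounds; lra|].
pose proof (growL_gt0 p z Hp Hz); pose proof (growR_gt0 p z Hp Hz).
assert (- grow p z <= turn p z <= grow p z) by (unfold turn, grow; split; nra).
apply pow_maj_Rabs, Rabs_le; lra.
Qed.

(* The discriminant condition with [phi = slope ^ 2 / (gap + grow * restore)] reduces to [0 <= slope ^ 2 * grow * restore * gap], whence the correction [eps]. *)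
Lemma weight_exists (p : params) (w c : R) :
  params_pos p -> is_perron p w c ->
  exists kap r flo fhi, 0 < kap /\ 0 < r /\ 0 < flo /\ forall z, 0 <= z <= 1 ->
    0 < gap p w z + grow p z * restore p w c z /\
    let phi := kap / (gap p w z + grow p z * restore p w c z) in
    flo <= phi <= fhi /\
    forall u v, r * (u ^ 2 + v ^ 2) <=
      phi * restore p w c z * u ^ 2 - (slope p c - turn p z * phi) * u * v + grow p z * v ^ 2.
Proof.
intros Hp HP; destruct (coefficient_bounds p w c Hp HP) as [lo [hi [Hlo [Hhi HB]]]].
set (s := slope p c).
(* Chosen so that [eps * turn ^ 2] is at most [4 * grow * restore * gap]. *)
set (eps := 4 * lo ^ 3 / hi ^ 2).
assert (Heps : 0 < eps) by (apply Rdiv_lt_0_compat; [|nra]; pose proof (pow_lt lo 3 Hlo); lra).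
set (kap := s ^ 2 + eps).
assert (Hkap : 0 < kap) by (unfold kap; pose proof (pow2_ge_0 s); lra).
set (dm := lo + lo ^ 2); set (dM := hi + hi ^ 2).
assert (Hdm : 0 < dm) by (unfold dm; nra); assert (HdM : 0 < dM) by (unfold dM; nra).
set (d := 4 * eps * lo ^ 3 / dM ^ 2).
assert (Hd : 0 < d).
{ apply Rdiv_lt_0_compat; [|apply pow_lt; lra].
  pose proof (pow_lt lo 3 Hlo); apply Rmult_lt_0_compat; lra. }
set (S := kap / dm * hi + hi).
assert (HS : 0 < S).
{ unfold S; assert (0 < kap / dm) by (apply Rdiv_lt_0_compat; lra); nra. }
exists kap, (d / (4 * S)), (kap / dM), (kap / dm).
split; [exact Hkap|]; split; [apply Rdiv_lt_0_compat; lra|]; split; [apply Rdiv_lt_0_compat; lra|].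
intros z Hz; destruct (HB z Hz) as [Ba [Bq [Be Bt]]].
pose proof (gap_eq p w c z HP) as EG; fold s in EG.
set (a := grow p z) in *; set (q := restore p w c z) in *; set (e := gap p w z) in *.
set (t := turn p z) in *.
assert (Baq : lo ^ 2 <= a * q <= hi ^ 2) by (split; nra).
assert (Baqe : lo ^ 3 <= a * q * e) by (replace (lo ^ 3) with (lo ^ 2 * lo) by ring; nra).
set (D := e + a * q) in *.
assert (HD : dm <= D <= dM) by (unfold D, dm, dM; lra).
split; [lra|]; intros phi.
assert (Hphi : kap / dM <= phi <= kap / dm).
{ unfold phi, Rdiv; split; (apply Rmult_le_compat_l; [lra | apply Rinv_le_contravar; lra]). }
assert (H0phi : 0 < phi) by (apply Rdiv_lt_0_compat; lra).
split; [exact Hphi|]; intros u v.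
assert (Hphiq : 0 <= phi * q) by (apply Rmult_le_pos; lra).
apply definite_form_bound; [exact Hphiq | lra | exact HS | | exact Hd |].
- unfold S; assert (phi * q <= kap / dm * hi) by (apply Rmult_le_compat; lra); lra.
- assert (HphiD : phi * D = kap) by (unfold phi; field; lra).
  assert (HD0 : 0 < D ^ 2) by (apply pow_lt; lra).
  assert (Het : eps * t ^ 2 <= 4 * (a * q * e)).
  { apply Rle_trans with (eps * hi ^ 2); [apply Rmult_le_compat_l; lra|].
    replace (eps * hi ^ 2) with (4 * lo ^ 3) by (unfold eps; field; lra); lra. }
  (* Since [D = t * s + 2 * a * q], one has [D ^ 2 - (t * s) ^ 2 = 4 * (a * q * e)]. Of the two
     copies of [eps * (4 * (a * q * e))], one absorbs [t ^ 2 * eps ^ 2] and the other leaves the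
     margin defining [d]. *)
  assert (Edet : D ^ 2 * (4 * (phi * q) * a - (s - t * phi) ^ 2)
                 = (s ^ 2 + 2 * eps) * (4 * (a * q * e)) - t ^ 2 * eps ^ 2).
  { transitivity (2 * kap * D ^ 2 - s ^ 2 * D ^ 2 - t ^ 2 * kap ^ 2).
    - rewrite <- HphiD; unfold D; rewrite <- EG; ring.
    - unfold kap, D; rewrite <- EG; ring. }
  apply Rmult_le_reg_l with (D ^ 2); [exact HD0|]; rewrite Edet.
  apply Rle_trans with (4 * eps * lo ^ 3).
  + unfold d; replace (4 * eps * lo ^ 3) with (dM ^ 2 * (4 * eps * lo ^ 3 / dM ^ 2)) at 2 by (field; lra).
    apply Rmult_le_compat_r; [apply Rlt_le, Hd | apply pow_incr; lra].
  + assert (0 <= s ^ 2 * (4 * (a * q * e))) by (apply Rmult_le_pos; [apply pow2_ge_0 | pose proof (pow_lt lo 3 Hlo); lra]).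
    assert (eps * (eps * t ^ 2) <= eps * (4 * (a * q * e))) by (apply Rmult_le_compat_l; lra).
    assert (eps * lo ^ 3 <= eps * (a * q * e)) by (apply Rmult_le_compat_l; lra).
    lra.
Qed.

(** * The two summands of the Lyapunov function *)

(** The derivative has the sign of [t - w], so [f] does not increase toward [w] from either side.
    Applied to differences, this compares functions that share a critical point. *)
Lemma le_of_derive_toward (f : R -> R) (w z : R) :
  (forall t, Rmin w z <= t <= Rmax w z ->
     exists k, 0 <= k /\ is_derive f t (k * (t - w))) ->
  f w <= f z.
Proof.
intros Hf.
assert (HA : w <= z \/ z <= w) by lra; destruct HA as [Hle|Hle].
- rewrite Rmin_left, Rmax_right in Hf by lra.
  destruct (MVT_Derive f w z Hle) as [s [Hs E]].
  { intros t Ht; destruct (Hf t Ht) as [k [_ Hk]]; eexists; exact Hk. }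
  destruct (Hf s Hs) as [k [Hk0 Hk]]; rewrite (is_derive_unique _ _ _ Hk) in E.
  assert (0 <= k * (s - w)) by (apply Rmult_le_pos; lra); nra.
- rewrite Rmin_right, Rmax_left in Hf by lra.
  destruct (MVT_Derive f z w Hle) as [s [Hs E]].
  { intros t Ht; destruct (Hf t Ht) as [k [_ Hk]]; eexists; exact Hk. }
  destruct (Hf s Hs) as [k [Hk0 Hk]]; rewrite (is_derive_unique _ _ _ Hk) in E.
  assert (0 <= k * (w - s)) by (apply Rmult_le_pos; lra); nra.
Qed.

(** [Phi] is the integral from [w]; the bounds on [phi] compare its derivative with those of two
    parabolas. *)
Lemma potential_exists (phi : R -> R) (w flo fhi : R) :
  (forall z, continuous phi z) -> (forall z, flo <= phi z <= fhi) ->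
  exists Phi : R -> R, forall z,
    is_derive Phi z (phi z * (z - w)) /\
    flo / 2 * (z - w) ^ 2 <= Phi z <= fhi / 2 * (z - w) ^ 2.
Proof.
intros Hc Hb.
set (F := fun z => phi z * (z - w)).
assert (HF : forall z, continuous F z).
{ intros z; apply (continuous_mult phi (fun z => z - w)); [apply Hc|].
  apply (ex_derive_continuous (fun z => z - w)); auto_derive; exact I. }
exists (RInt F w).
assert (HD : forall z, is_derive (RInt F w) z (F z)).
{ intros z; apply (is_derive_RInt F (RInt F w) w z); [|apply HF].
  apply filter_forall; intros y; apply (RInt_correct (V := R_CompleteNormedModule)).
  apply (ex_RInt_continuous (V := R_CompleteNormedModule)); intros; apply HF. }
assert (H0 : RInt F w w = 0) by (apply (RInt_point (V := R_CompleteNormedModule))).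
intros z; split; [apply HD|].
split.
- assert (H : RInt F w w - flo / 2 * (w - w) ^ 2 <= RInt F w z - flo / 2 * (z - w) ^ 2).
  { apply (le_of_derive_toward (fun t => RInt F w t - flo / 2 * (t - w) ^ 2)).
    intros t _; exists (phi t - flo); split; [specialize (Hb t); lra|].
    replace ((phi t - flo) * (t - w)) with (F t - flo * (t - w)) by (unfold F; ring).
    apply (is_derive_minus (V := R_NormedModule)); [apply HD | auto_derive; [exact I | field]]. }
  rewrite H0 in H; lra.
- assert (H : fhi / 2 * (w - w) ^ 2 - RInt F w w <= fhi / 2 * (z - w) ^ 2 - RInt F w z).
  { apply (le_of_derive_toward (fun t => fhi / 2 * (t - w) ^ 2 - RInt F w t)).
    intros t _; exists (fhi - phi t); split; [specialize (Hb t); lra|].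
    replace ((fhi - phi t) * (t - w)) with (fhi * (t - w) - F t) by (unfold F; ring).
    apply (is_derive_minus (V := R_NormedModule)); [auto_derive; [exact I | field] | apply HD]. }
  rewrite H0 in H; lra.
Qed.

(** The Lotka-Volterra function: its derivative [(N - n) / N] cancels the factor [N] in [N']. *)
Definition volterra (n N : R) : R := N - n - n * ln (N / n).

Lemma is_derive_volterra (n N : R) :
  0 < n -> 0 < N -> is_derive (volterra n) N ((N - n) / N).
Proof.
intros Hn HN; unfold volterra; auto_derive.
- apply Rdiv_lt_0_compat; lra.
- field; lra.
Qed.

(** Below, [/ t >= 1 > n] compares derivatives; above, the derivatives differ by
    [n * (t - n) / t ^ 2]. The upper bound degenerates as [N] tends to 0, which is harmless near
    [n]. *)
Lemma volterra_bounds (n N : R) :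
  0 < n < 1 -> 0 < N <= 1 ->
  n / 2 * (N - n) ^ 2 <= volterra n N <= (N - n) ^ 2 / N.
Proof.
intros Hn HN.
assert (H0 : volterra n n = 0).
{ unfold volterra; replace (n / n) with 1 by (field; lra); rewrite ln_1; ring. }
assert (Hpos : forall t, Rmin n N <= t <= Rmax n N -> 0 < t <= 1).
{ intros t Ht; unfold Rmin, Rmax in Ht; destruct (Rle_dec n N); lra. }
split.
- assert (H : volterra n n - n / 2 * (n - n) ^ 2 <= volterra n N - n / 2 * (N - n) ^ 2).
  { apply (le_of_derive_toward (fun t => volterra n t - n / 2 * (t - n) ^ 2)).
    intros t Ht; specialize (Hpos t Ht); exists (/ t - n); split.
    - assert (1 <= / t) by (rewrite <- Rinv_1; apply Rinv_le_contravar; lra); lra.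
    - replace ((/ t - n) * (t - n)) with ((t - n) / t - n * (t - n)) by (field; lra).
      apply (is_derive_minus (V := R_NormedModule));
        [apply is_derive_volterra; lra | auto_derive; [exact I | field]]. }
  rewrite H0 in H; lra.
- assert (H : (n - n) ^ 2 / n - volterra n n <= (N - n) ^ 2 / N - volterra n N).
  { apply (le_of_derive_toward (fun t => (t - n) ^ 2 / t - volterra n t)).
    intros t Ht; specialize (Hpos t Ht); exists (n / t ^ 2); split.
    - apply Rlt_le, Rdiv_lt_0_compat; [lra | apply pow_lt; lra].
    - replace (n / t ^ 2 * (t - n)) with ((t ^ 2 - n ^ 2) / t ^ 2 - (t - n) / t) by (field; lra).
      apply (is_derive_minus (V := R_NormedModule));
        [auto_derive; [lra | field; lra] | apply is_derive_volterra; lra]. }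
  rewrite H0 in H; replace ((n - n) ^ 2 / n) with 0 in H by (field; lra); lra.
Qed.

(** * Global stability of the interior equilibrium *)

(** On the simplex [N' >= - (muL p + muR p) * N], so the total decays at most exponentially and the
    origin is not reached. *)
Lemma total_gt0 (p : params) (x y : R -> R) :
  params_pos p -> is_solution p x y -> in_Sigma (x 0) (y 0) -> 0 < x 0 + y 0 ->
  forall t, 0 <= t -> 0 < x t + y t.
Proof.
intros Hp Hsol H0 HN T HT; pose proof (Sigma_invariant p x y Hp Hsol H0) as Hinv.
destruct Hp as [h1 [h2 [h3 [h4 [h5 h6]]]]].
set (m := muL p + muR p).
assert (H : - (x T + y T) * exp (m * T) - - (x 0 + y 0) * exp (m * 0) <= 0 * (T - 0)).
{ apply (derive_le_bound (fun t => - (x t + y t) * exp (m * t)) 0 T 0 HT).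
  intros t [Ht _]; destruct (Hsol t Ht) as [Hx Hy]; destruct (Hinv t Ht) as [Ha [Hb Hab]].
  exists (- (fL p (x t) (y t) + fR p (x t) (y t) + m * (x t + y t)) * exp (m * t)); split.
  - auto_derive; [split; [eexists; exact Hx | split; [eexists; exact Hy | exact I]]|].
    replace (Derive (fun u => x u) t) with (fL p (x t) (y t))
      by (symmetry; exact (is_derive_unique _ _ _ Hx)).
    replace (Derive (fun u => y u) t) with (fR p (x t) (y t))
      by (symmetry; exact (is_derive_unique _ _ _ Hy)).
    ring.
  - pose proof (exp_pos (m * t)).
    assert (0 <= fL p (x t) (y t) + fR p (x t) (y t) + m * (x t + y t)).
    { unfold fL, fR, m; set (a := x t) in *; set (b := y t) in *; set (cc := 1 - a - b).
      assert (Hcc : 0 <= cc) by (unfold cc; lra).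
      assert (0 <= (aL p + gLR p) * (a * cc)) by (repeat apply Rmult_le_pos; lra).
      assert (0 <= (aR p + gRL p) * (b * cc)) by (repeat apply Rmult_le_pos; lra).
      assert (0 <= muL p * b) by (apply Rmult_le_pos; lra).
      assert (0 <= muR p * a) by (apply Rmult_le_pos; lra).
      lra. }
    nra. }
rewrite Rmult_0_r, exp_0 in H; pose proof (exp_pos (m * T)); nra.
Qed.

Lemma share_coordinates (a b : R) :
  in_Sigma a b -> 0 < a + b ->
  0 <= a / (a + b) <= 1 /\
  a / (a + b) * (a + b) = a /\ (1 - a / (a + b)) * (a + b) = b.
Proof.
intros [Ha [Hb _]] HN.
assert (E : a / (a + b) * (a + b) = a) by (field; lra).
split; [|split; [exact E | rewrite Rmult_minus_distr_r, E; ring]].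
split; apply Rmult_le_reg_r with (a + b); lra.
Qed.

Lemma GAS_interior (p : params) (w c : R) :
  params_pos p -> is_perron p w c -> c < 1 ->
  GAS_on p (fun L Rr => in_Sigma L Rr /\ ~ (L = 0 /\ Rr = 0))
    (w * (1 - c)) ((1 - w) * (1 - c)).
Proof.
intros Hp HP Hc1.
destruct (weight_exists p w c Hp HP) as [kap [r [flo [fhi [Hkap [Hr [Hflo HW]]]]]]].
pose proof HP as [Hw [Hc _]].
set (n := 1 - c); assert (Hn : 0 < n < 1) by (unfold n; lra).
(* The projection onto [[0, 1]], written with absolute values to make continuity immediate. It
   extends the weight to all reals with the same bounds, whereas [D] may vanish outside [[0, 1]]. *)
set (clamp := fun z => (Rabs z + (1 - Rabs (z - 1))) / 2).
assert (Hclamp : forall z, 0 <= clamp z <= 1).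
{ intros z; unfold clamp, Rabs; destruct (Rcase_abs z), (Rcase_abs (z - 1)); lra. }
assert (Hclamp_id : forall z, 0 <= z <= 1 -> clamp z = z).
{ intros z Hz; unfold clamp; rewrite Rabs_pos_eq, Rabs_left1; lra. }
set (D := fun z => gap p w z + grow p z * restore p w c z).
set (phi := fun z => kap / D (clamp z)).
assert (Hphi : forall z, flo <= phi z <= fhi).
{ intros z; apply (HW (clamp z) (Hclamp z)). }
destruct (potential_exists phi w flo fhi) as [Phi HPhi].
{ intros z; apply (continuous_comp clamp (fun u => kap / D u)).
  - apply continuity_pt_filterlim; unfold clamp; reg.
  - apply (ex_derive_continuous (fun u => kap / D u)).
    destruct (HW (clamp z) (Hclamp z)) as [HD _]; fold (D (clamp z)) in HD.
    unfold D, gap, grow, restore, growL, growR in *; auto_derive; lra. }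
{ exact Hphi. }
set (m := Rmin (Rmin (flo / 2) (n / 2)) r).
assert (Hm : 0 < m) by (unfold m; repeat apply Rmin_pos; lra).
assert (m1 : m <= flo / 2) by (unfold m; eapply Rle_trans; [apply Rmin_l | apply Rmin_l]).
assert (m2 : m <= n / 2) by (unfold m; eapply Rle_trans; [apply Rmin_l | apply Rmin_r]).
assert (m3 : m <= r) by apply Rmin_r.
assert (Hdom : forall a b, in_Sigma a b /\ ~ (a = 0 /\ b = 0) -> 0 < a + b).
{ intros a b [[Ha [Hb _]] Hne]; apply Rnot_le_lt; intros Hle; apply Hne; lra. }
(* Compares distances in [(L, R)] and in [(z, N)]; the factor 4 accounts for the constant [m / 4]
   below. *)
assert (Hdist : forall z N, 0 <= z <= 1 -> 0 < N <= 1 ->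
  (z * N - w * n) ^ 2 + ((1 - z) * N - (1 - w) * n) ^ 2 <= 4 * ((z - w) ^ 2 + (N - n) ^ 2)).
{ intros z N Hz HN.
  replace (z * N - w * n) with ((z - w) * N + w * (N - n)) by ring.
  replace ((1 - z) * N - (1 - w) * n) with (- ((z - w) * N) + (1 - w) * (N - n)) by ring.
  set (s := (z - w) * N); set (h := N - n).
  assert (Hs : s ^ 2 <= (z - w) ^ 2).
  { unfold s; rewrite Rpow_mult_distr; pose proof (pow2_ge_0 (z - w)).
    assert (N ^ 2 <= 1) by nra; nra. }
  pose proof (pow2_ge_0 h).
  assert (w ^ 2 <= 1) by nra; assert ((1 - w) ^ 2 <= 1) by nra.
  pose proof (pow2_ge_0 (s - w * h)); pose proof (pow2_ge_0 (s + (1 - w) * h)).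
  assert (w ^ 2 * h ^ 2 <= 1 * h ^ 2) by (apply Rmult_le_compat_r; lra).
  assert ((1 - w) ^ 2 * h ^ 2 <= 1 * h ^ 2) by (apply Rmult_le_compat_r; lra).
  lra. }
apply (GAS_of_lyapunov p _ _ _ (fun a b => Phi (a / (a + b)) + volterra n (a + b)) (m / 4)).
- lra.
- intros x y Hsol H0 t Ht; pose proof (Hdom _ _ H0); destruct H0 as [H0 _].
  split; [now apply (Sigma_invariant p)|].
  pose proof (total_gt0 p x y Hp Hsol H0 H t Ht); lra.
- intros a b Hab; pose proof (Hdom a b Hab) as HN; destruct Hab as [HS _].
  destruct (share_coordinates a b HS HN) as [Hz [Ea Eb]]; destruct HS as [_ [_ HN1]].
  rewrite dist2_sq; fold n.
  set (z := a / (a + b)) in *; set (N := a + b) in *; rewrite <- Ea, <- Eb.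
  assert (HN' : 0 < N <= 1) by lra.
  pose proof (Hdist z N Hz HN'); destruct (HPhi z) as [_ [P1 _]].
  destruct (volterra_bounds n N Hn HN') as [V1 _].
  pose proof (pow2_ge_0 (z - w)); pose proof (pow2_ge_0 (N - n)).
  assert (m * (z - w) ^ 2 <= flo / 2 * (z - w) ^ 2) by (apply Rmult_le_compat_r; lra).
  assert (m * (N - n) ^ 2 <= n / 2 * (N - n) ^ 2) by (apply Rmult_le_compat_r; lra).
  nra.
- intros beta Hbeta; fold n.
  (* The first two terms bound [Phi] and [volterra] by multiples of [d ^ 2] once [N >= n / 2]. *)
  set (M := fhi * 4 / n ^ 2 + 8 / n + 1).
  assert (Hfhi : 0 < fhi) by (specialize (Hphi 0); lra).
  assert (HM1 : 0 < fhi * 4 / n ^ 2) by (apply Rdiv_lt_0_compat; [lra | apply pow_lt; lra]).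
  assert (HM2 : 0 < 8 / n) by (apply Rdiv_lt_0_compat; lra).
  (* The bound [n / 4] keeps [N] above [n / 2], as [N - n] is at most [2 * d] in size, and gives
     [d ^ 2 <= d]. *)
  set (delta := Rmin (n / 4) (beta / M)).
  assert (HM : 0 < M) by (unfold M; lra).
  exists delta; split.
  { apply Rmin_pos; [lra | apply Rdiv_lt_0_compat; lra]. }
  intros a b Hab Hd; pose proof (Hdom a b Hab) as HN; destruct Hab as [HS _].
  destruct (share_coordinates a b HS HN) as [Hz [Ea Eb]]; destruct HS as [_ [_ HN1]].
  pose proof (dist2_sq a b (w * n) ((1 - w) * n)) as Ed.
  pose proof (dist2_ge0 a b (w * n) ((1 - w) * n)) as Gd.
  set (d := dist2 a b (w * n) ((1 - w) * n)) in *.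
  assert (Hd1 : d < n / 4) by (eapply Rlt_le_trans; [exact Hd | apply Rmin_l]).
  assert (Hd2 : M * d < beta).
  { assert (Hdb : d < beta / M) by (eapply Rlt_le_trans; [exact Hd | apply Rmin_r]).
    apply Rmult_lt_compat_l with (r := M) in Hdb; [|exact HM].
    replace (M * (beta / M)) with beta in Hdb by (field; lra); exact Hdb. }
  set (z := a / (a + b)) in *; set (N := a + b) in *.
  assert (HN' : 0 < N <= 1) by lra.
  set (u := a - w * n) in *; set (v := b - (1 - w) * n) in *.
  assert (EN : N - n = u + v) by (unfold N, u, v; ring).
  assert (Ez : (z - w) * N = (1 - w) * u - w * v).
  { rewrite Rmult_minus_distr_r, Ea; unfold N, u, v; ring. }
  assert (HNn : (N - n) ^ 2 <= 4 * d ^ 2).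
  { rewrite EN; pose proof (pow2_ge_0 (u - v)); nra. }
  assert (HNlow : n / 2 <= N).
  { apply Rnot_lt_le; intros Hlt; nra. }
  assert (Hzw : (z - w) ^ 2 * N ^ 2 <= 2 * d ^ 2).
  { rewrite <- Rpow_mult_distr, Ez, Ed.
    pose proof (pow2_ge_0 ((1 - w) * u + w * v)).
    assert ((1 - w) ^ 2 * u ^ 2 <= 1 * u ^ 2) by (apply Rmult_le_compat_r; [apply pow2_ge_0 | nra]).
    assert (w ^ 2 * v ^ 2 <= 1 * v ^ 2) by (apply Rmult_le_compat_r; [apply pow2_ge_0 | nra]).
    lra. }
  assert (Hz2 : (z - w) ^ 2 <= 8 * d ^ 2 / n ^ 2).
  { apply Rmult_le_reg_r with (n ^ 2); [apply pow_lt; lra|].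
    replace (8 * d ^ 2 / n ^ 2 * n ^ 2) with (8 * d ^ 2) by (field; lra).
    assert ((n / 2) ^ 2 <= N ^ 2) by (apply pow_incr; lra).
    assert ((z - w) ^ 2 * (n / 2) ^ 2 <= (z - w) ^ 2 * N ^ 2)
      by (apply Rmult_le_compat_l; [apply pow2_ge_0 | lra]).
    lra. }
  assert (HV : (N - n) ^ 2 / N <= 8 / n * d ^ 2).
  { apply Rmult_le_reg_r with N; [lra|].
    replace ((N - n) ^ 2 / N * N) with ((N - n) ^ 2) by (field; lra).
    apply Rle_trans with (1 := HNn).
    replace (4 * d ^ 2) with (8 / n * d ^ 2 * (n / 2)) by (field; lra).
    apply Rmult_le_compat_l; [apply Rmult_le_pos; [lra | apply pow2_ge_0] | exact HNlow]. }
  destruct (HPhi z) as [_ [_ P2]]; destruct (volterra_bounds n N Hn HN') as [_ V2].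
  assert (HP2 : fhi / 2 * (z - w) ^ 2 <= fhi * 4 / n ^ 2 * d ^ 2).
  { replace (fhi * 4 / n ^ 2 * d ^ 2) with (fhi / 2 * (8 * d ^ 2 / n ^ 2)) by (field; lra).
    apply Rmult_le_compat_l; lra. }
  assert (HMd : M * d ^ 2 <= M * d) by (apply Rmult_le_compat_l; [lra | nra]).
  apply Rle_lt_trans with (M * d); [|exact Hd2].
  apply Rle_trans with (2 := HMd); unfold M; pose proof (pow2_ge_0 d); lra.
- intros x y t Hsol Ht Hab; pose proof (Hdom _ _ Hab) as HN; destruct Hab as [HS _].
  destruct (share_coordinates _ _ HS HN) as [Hz [Ea Eb]]; destruct HS as [_ [_ HN1]].
  destruct (Hsol t Ht) as [Hx Hy].
  pose proof (share_dynamics p w c (x t / (x t + y t)) (x t + y t) HP) as [S1 S2].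
  rewrite Ea, Eb in S1, S2.
  set (gL := fL p (x t) (y t)) in *; set (gR := fR p (x t) (y t)) in *.
  assert (HxyD : is_derive (fun s => x s + y s) t (gL + gR))
    by now apply (is_derive_plus (V := R_NormedModule)).
  set (z := x t / (x t + y t)) in *; set (N := x t + y t) in *.
  assert (HzD : is_derive (fun s => x s / (x s + y s)) t (((1 - z) * gL - z * gR) / N)).
  { auto_derive.
    - split; [eexists; exact Hx | split; [eexists; exact Hx | split; [eexists; exact Hy | split; [fold N; lra | exact I]]]].
    - replace (Derive (fun u => x u) t) with gL by (symmetry; exact (is_derive_unique _ _ _ Hx)).
      replace (Derive (fun u => y u) t) with gR by (symmetry; exact (is_derive_unique _ _ _ Hy)).
      unfold z, N in *; field; lra. }
  exists (((1 - z) * gL - z * gR) / N * (phi z * (z - w)) + (gL + gR) * ((N - n) / N)); split.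
  + apply (is_derive_plus (V := R_NormedModule)).
    * apply (is_derive_comp Phi (fun s => x s / (x s + y s)) t); [apply HPhi | exact HzD].
    * apply (is_derive_comp (volterra n) (fun s => x s + y s) t); [|exact HxyD].
      apply is_derive_volterra; lra.
  + rewrite dist2_sq; fold n; rewrite <- Ea, <- Eb.
    assert (HN' : 0 < N <= 1) by lra.
    pose proof (Hdist z N Hz HN') as Hdz.
    destruct (HW z Hz) as [HD [_ Hform]]; specialize (Hform (z - w) (N - n)).
    (* The actual share lies in [[0, 1]], where the clamped weight is the one making the form
       definite. *)
    assert (Ephi : phi z = kap / (gap p w z + grow p z * restore p w c z))
      by (unfold phi, D; now rewrite Hclamp_id).
    rewrite <- Ephi in Hform; rewrite S1, S2; fold n.
    pose proof (pow2_ge_0 (z - w)); pose proof (pow2_ge_0 (N - n)).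
    assert (m * ((z - w) ^ 2 + (N - n) ^ 2) <= r * ((z - w) ^ 2 + (N - n) ^ 2))
      by (apply Rmult_le_compat_r; lra).
    apply Rle_trans with (- (r * ((z - w) ^ 2 + (N - n) ^ 2))); [|nra].
    eapply Rle_trans; [apply Req_le | apply Ropp_le_contravar, Hform].
    field; lra.
Qed.

Theorem theorem3p12 (p : params) (lamPF : R) :
  params_pos p ->
  is_spectral_radius (NGM p) lamPF ->
  (lamPF <= 1 -> GAS_on p in_Sigma 0 0) /\
  (1 < lamPF ->
     exists Ls Rs : R,
       is_interior_equilibrium p Ls Rs /\
       (forall L' R', is_interior_equilibrium p L' R' -> L' = Ls /\ R' = Rs) /\
       GAS_on p (fun L Rr => in_Sigma L Rr /\ ~ (L = 0 /\ Rr = 0)) Ls Rs).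
Proof.
intros Hp Hlam; destruct (perron_exists p Hp) as [w [c HP]].
pose proof (spectral_radius_perron p lamPF w c Hp HP Hlam) as Elam.
pose proof HP as [Hw [Hc _]]; split; intros H1.
- apply (GAS_origin p w c Hp HP); nra.
- assert (Hc1 : c < 1) by nra.
  exists (w * (1 - c)), ((1 - w) * (1 - c)); split; [|split].
  + now apply perron_interior_equilibrium.
  (* The Perron pair of an equilibrium determines it: [L' + R'] is [1 - c] and the left share is
     [w]. *)
  + intros L' R' HE; pose proof (interior_equilibrium_perron p L' R' HE) as HP'.
    destruct (perron_unique p w c _ _ Hp HP HP') as [Ew Ec].
    destruct HE as [_ [HL [HR _]]].
    rewrite <- Ew, <- Ec; split; field; lra.
  + now apply GAS_interior.
Qed.
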